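(* Let $G$ be an edge-colored complete graph that is heterochromatic triangle free. Then for every vertex $u$ of $G$, $G$ has a heterochromatic $u$-path of length at least $d^c(u)$.
   Context: Graphs are finite and simple, with nonempty vertex set. An edge coloring of a graph $G=(V,E)$ is an arbitrary function $C:E\to\mathbb{N}$ (adjacent edges may receive the same color); $G$ together with such a coloring is an edge-colored graph, and $C(e)$ is the color of the edge $e$. The color degree $d^c(v)$ of a vertex $v$ is the number of different colors appearing on the edges incident with $v$. A subgraph (path, triangle, etc.) is heterochromatic if any two distinct edges of it have different colors. An edge-colored graph is heterochromatic triangle free if it contains no heterochromatic triangle. A path has no repeated vertices, and its length is its number of edges; a $u$-path is a path that starts from the vertex $u$ (i.e. has $u$ as an end-vertex). *)

(* Defs.v *)
From mathcomp Require Import all_boot.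

Set Implicit Arguments.
Unset Strict Implicit.
Unset Printing Implicit Defensive.

(* Finite simple graph on T with an edge coloring; an edge xy is the unordered
   pair [set x; y]. The coloring is total on {set T}, but only its values on
   edges are ever used below. *)
Record ecgraph (T : finType) := ECGraph {
  adj : rel T;
  color : {set T} -> nat;
  adj_sym : symmetric adj;
  adj_irrefl : irreflexive adj }.

Definition complete (T : finType) (G : ecgraph T) : Prop :=
  forall x y : T, x != y -> adj G x y.

Definition color_degree (T : finType) (G : ecgraph T) (v : T) : nat :=
  size (undup [seq color G [set v; w] | w <- enum T & adj G v w]).

(* A subgraph enters only through its edge set F. *)
Definition heterochromatic (T : finType) (G : ecgraph T)
    (F : {set {set T}}) : Prop :=
  {in F &, forall e f, e != f -> color G e != color G f}.

Definition is_triangle (T : finType) (G : ecgraph T) (x y z : T) : bool :=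
  [&& adj G x y, adj G y z & adj G x z].

Definition triangle_edges (T : finType) (x y z : T) : {set {set T}} :=
  [set [set x; y]; [set y; z]; [set x; z]].

Definition heterochromatic_triangle_free (T : finType) (G : ecgraph T) : Prop :=
  forall x y z : T, is_triangle G x y z ->
    ~ heterochromatic G (triangle_edges x y z).

(* The path visits the vertices u :: p in this order; its length is size p. *)
Definition is_path_from (T : finType) (G : ecgraph T) (u : T) (p : seq T) : bool :=
  path (adj G) u p && uniq (u :: p).

(* pairmap lists the pairs of consecutive vertices of u :: p. *)
Definition path_edges (T : finType) (u : T) (p : seq T) : {set {set T}} :=
  [set e in pairmap (fun x y => [set x; y]) u p].

(* Main.v *)
Require Import Defs.
From mathcomp Require Import all_boot.

(** Pick neighbours of u, one for each color c(uw) seen at u.  For two of them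
    x, y, the triangle uxy forces the color of xy to be c(ux) or c(uy), so
    "xy has color c(uy)" is a tournament on the chosen vertices.  Along a
    Hamiltonian path of the tournament, preceded by u, the edge entering each
    vertex y has color c(uy), and these colors are distinct. *)

Lemma undup_map_reps (T U : eqType) (f : T -> U) (s : seq T) :
  exists2 t, {subset t <= s} & map f t = undup (map f s).
Proof.
elim: s => [|x s [t ts ft]] /=; first by exists [::].
case: ifP => _; last first.
  exists (x :: t); last by rewrite /= ft.
  by move=> y; rewrite !inE => /orP[-> // | /ts ->]; rewrite orbT.
by exists t => // y /ts; rewrite inE orbC => ->.
Qed.

Lemma uniq_map_in_inj (T U : eqType) (f : T -> U) (s : seq T) :
  uniq (map f s) -> {in s &, injective f}.
Proof.
elim: s => //= x s IHs /andP[fxNs /IHs inj_s] y z; rewrite !inE.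
move=> /predU1P[->|ys] /predU1P[->|zs] // eq_f; last exact: inj_s.
  by rewrite eq_f map_f in fxNs.
by rewrite -eq_f map_f in fxNs.
Qed.

Section StarOrder.

Variables (T : finType) (G : ecgraph T) (u : T).

Definition star_color (x : T) : nat := color G [set u; x].

(* The first disjunct makes the relation total, so that [sort] produces a
   Hamiltonian path of the tournament: [sort_sorted] needs no transitivity. *)
Definition star_le (x y : T) : bool :=
  (star_color x == star_color y) || (color G [set x; y] == star_color y).

Lemma star_le_root (x : T) : star_le u x.
Proof. by rewrite /star_le eqxx orbT. Qed.

Lemma star_le_total :
  complete G -> heterochromatic_triangle_free G -> total star_le.
Proof.
move=> Gc Ghtf x y.
(* Totality ranges over all of [T], hence over [u] too, where [star_color] is the color of the
   singleton [[set u]], not of an edge. *)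
have [->|xu] := eqVneq x u; first by rewrite star_le_root.
have [->|yu] := eqVneq y u; first by rewrite star_le_root orbT.
(* If [x] and [y] were incomparable, the triangle [u x y] would have three distinct colors. *)
apply/negPn/negP; rewrite /star_le !negb_or (setUC [set y]).
move=> /andP[/andP[cxy exy] /andP[_ eyx]].
have xy : x != y by apply: contraNneq cxy => ->.
apply: (Ghtf u x y); first by rewrite /is_triangle !Gc // eq_sym.
move=> e f; rewrite !inE -!orbA => /or3P[] /eqP-> /or3P[] /eqP->.
all: by rewrite ?eqxx // => _; first [done | rewrite eq_sym].
Qed.

(** Distinct star colors rule out the first disjunct of [star_le], so each edge takes the star color
    of its later endpoint. *)
Lemma color_pairmap_star (x : T) (p : seq T) :
  path star_le x p -> uniq (map star_color (x :: p)) ->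
  map (color G) (pairmap (fun y z => [set y; z]) x p) = map star_color p.
Proof.
elim: p x => //= y p IHp x /andP[le_xy le_p] /andP[cxNp Up].
rewrite IHp //; case/orP: le_xy => /eqP eq_c; last by rewrite eq_c.
by rewrite eq_c mem_head in cxNp.
Qed.

End StarOrder.

Theorem theorem2p1 (T : finType) (G : ecgraph T)
    (G_complete : complete G)
    (G_htf : heterochromatic_triangle_free G) (u : T) :
  exists p : seq T,
    [/\ is_path_from G u p,
        heterochromatic G (path_edges u p) &
        color_degree G u <= size p].
Proof.
have [t tN ct] :=
  undup_map_reps _ _ (star_color T G u) [seq w <- enum T | adj G u w].
have Uct : uniq (map (star_color T G u) t) by rewrite ct undup_uniq.
pose p := sort (star_le T G u) t; exists p.
have pt : perm_eq p t by rewrite perm_sort.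
have Ucp : uniq (map (star_color T G u) p).
  by rewrite (perm_uniq (perm_map _ pt)).
have Uup : uniq (u :: p).
  rewrite /= (map_uniq Ucp) andbT (perm_mem pt).
  by apply/negP => /tN; rewrite mem_filter adj_irrefl.
split.
- rewrite /is_path_from Uup andbT.
  apply: (@sub_path _ (fun x y => x != y)) => [x y|]; first exact: G_complete.
  by move: Uup; rewrite uniq_pairwise => /pairwise_sorted.
- have cp : map (color G) (pairmap (fun y z => [set y; z]) u p)
            = map (star_color T G u) p.
    (* The edge from [u] to the first vertex of [p] has the right color by definition; sortedness
       handles the later edges. *)
    have := sort_sorted (star_le_total T G u G_complete G_htf) t.
    rewrite -/p; case: p Ucp {pt Uup} => //= y q Ucq le_q.
    by rewrite (color_pairmap_star T G u).
  move=> e f; rewrite !inE => eP fP; apply: contra_neq.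
  by apply: (uniq_map_in_inj _ _ _ _ _ e f eP fP); rewrite cp.
- by rewrite (perm_size pt) -(size_map (star_color T G u)) ct.
Qed.
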